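(* One has $$\mathsf V\bigl(S_c^*(\{a_1\cdots a_m:m\ge1\})\bigr)=\bigvee_{k\ge1}\mathsf V\bigl(S_c^*(a_1\cdots a_k)\bigr).$$ This variety is locally finite and is not generated by finitely many finite algebras.
   Context: An ai-semiring (additively idempotent semiring) is an algebra $(S,+,\cdot)$ with two binary operations such that $(S,+)$ is a commutative idempotent semigroup, $(S,\cdot)$ is a semigroup, and both distributive laws hold. The signature is $(+,\cdot)$, with no constants. $\mathsf V(S)$ denotes the variety generated by $S$, and $\bigvee$ denotes the join in the lattice of varieties. A variety is locally finite if all its finitely generated members are finite. Let $a_1,a_2,\ldots$ be distinct letters. For $k\ge1$, the semiring $S_c^*(a_1\cdots a_k)$ has as its nonzero elements all nonempty square-free commutative words on $\{a_1,\ldots,a_k\}$ (equivalently, nonempty subsets of $\{a_1,\dots,a_k\}$), together with an element $0$ absorbing for both addition and multiplication. For nonzero $u,v$: $u+v$ is the square-free word whose set of letters is the union of the sets of letters of $u$ and $v$; $u\cdot v$ is the square-free word $uv$ if $u$ and $v$ have no letter in common, and $u\cdot v=0$ otherwise. The semiring $S_c^*(\{a_1\cdots a_m:m\ge1\})$ is defined in the same way, with nonzero elements all nonempty (finite) square-free commutative words on the infinite alphabet $\{a_1,a_2,\ldots\}$. *)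

(* Defs.v *)
From mathcomp Require Import all_boot.
From mathcomp Require Import finmap.
From mathcomp Require Import boolp classical_sets functions cardinality.

Set Implicit Arguments.
Unset Strict Implicit.
Unset Printing Implicit Defensive.

Local Open Scope classical_set_scope.

(* Algebras in the signature (+, .), without constants; as is usual in
   universal algebra, the carrier is required to be nonempty. *)
Record aiSemiring := AiSemiring {
  carrier :> Type;
  add : carrier -> carrier -> carrier;
  mul : carrier -> carrier -> carrier;
  carrier_nonempty : inhabited carrier;
  addA : associative add;
  addC : commutative add;
  addxx : idempotent_op add;
  mulA : associative mul;
  mulDl : left_distributive mul add;
  mulDr : right_distributive mul add
}.

Arguments add {a} x y : rename.
Arguments mul {a} x y : rename.

Definition is_hom (A B : aiSemiring) (f : A -> B) : Prop :=
  {morph f : x y / add x y >-> add x y} /\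
  {morph f : x y / mul x y >-> mul x y}.

Section Product.
Variables (I : Type) (A : I -> aiSemiring).

Let P := forall i, A i.
Let padd (x y : P) : P := fun i => add (x i) (y i).
Let pmul (x y : P) : P := fun i => mul (x i) (y i).

Fact prod_nonempty : inhabited P.
Proof. by constructor=> i; apply: inhabited_witness (carrier_nonempty (A i)). Qed.

Fact prod_addA : associative padd.
Proof. by move=> x y z; apply: functional_extensionality_dep => i; apply: addA. Qed.

Fact prod_addC : commutative padd.
Proof. by move=> x y; apply: functional_extensionality_dep => i; apply: addC. Qed.

Fact prod_addxx : idempotent_op padd.
Proof. by move=> x; apply: functional_extensionality_dep => i; apply: addxx. Qed.

Fact prod_mulA : associative pmul.
Proof. by move=> x y z; apply: functional_extensionality_dep => i; apply: mulA. Qed.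

Fact prod_mulDl : left_distributive pmul padd.
Proof. by move=> x y z; apply: functional_extensionality_dep => i; apply: mulDl. Qed.

Fact prod_mulDr : right_distributive pmul padd.
Proof. by move=> x y z; apply: functional_extensionality_dep => i; apply: mulDr. Qed.

Definition prod_aiSemiring : aiSemiring :=
  AiSemiring prod_nonempty prod_addA prod_addC prod_addxx
             prod_mulA prod_mulDl prod_mulDr.

End Product.

(* Classes of algebras are not of type [set aiSemiring]: [set] is confined to a
   universe below which the carriers [option word] would then not fit. *)
Definition algebra_class := aiSemiring -> Prop.

(* Closure under homomorphic images, subalgebras (presented by embeddings, so
   that the class is also closed under isomorphism) and arbitrary products. *)
Definition variety (K : algebra_class) : Prop :=
  [/\ forall (A B : aiSemiring) (f : A -> B),
        is_hom f -> (forall y, exists x, f x = y) -> K A -> K B,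
      forall (A B : aiSemiring) (f : A -> B),
        is_hom f -> injective f -> K B -> K A
    & forall (I : Type) (A : I -> aiSemiring),
        (forall i, K (A i)) -> K (prod_aiSemiring A)].

Definition variety_gen (F : algebra_class) : algebra_class :=
  fun A => forall K, variety K -> (forall B, F B -> K B) -> K A.

Definition V (S : aiSemiring) : algebra_class := variety_gen (fun B => B = S).

Definition variety_join (I : Type) (D : I -> Prop) (W : I -> algebra_class) :
  algebra_class := variety_gen (fun B => exists2 i, D i & W i B).

Definition same_class (K L : algebra_class) : Prop := forall A, K A <-> L A.

Definition finite_algebra (A : aiSemiring) : Prop := finite_set [set: A].

Definition subalgebra (A : aiSemiring) (X : set A) : Prop :=
  forall x y, X x -> X y -> X (add x y) /\ X (mul x y).

Definition finitely_generated (A : aiSemiring) : Prop :=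
  exists2 G : set A, finite_set G & smallest (@subalgebra A) G = [set: A].

Definition locally_finite (K : algebra_class) : Prop :=
  forall A : aiSemiring, K A -> finitely_generated A -> finite_algebra A.

Definition generated_by_finitely_many_finite (K : algebra_class) : Prop :=
  exists (n : nat) (A : 'I_n -> aiSemiring),
    (forall i, finite_algebra (A i)) /\
    same_class (variety_gen (fun B => exists i, B = A i)) K.

Section SquareFreeWords.
Local Open Scope fset_scope.
Variable T : choiceType.

(* A nonempty square-free commutative word is identified with its set of
   letters. *)
Definition word := {X : {fset T} | X != fset0}.

Fact word_cat_subproof (u v : word) : val u `|` val v != fset0.
Proof. by rewrite fsetU_eq0 negb_and (valP u). Qed.

Definition word_cat (u v : word) : word :=
  exist _ (val u `|` val v) (word_cat_subproof u v).

(* [None] is the absorbing element 0. *)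
Definition Sc_add (x y : option word) : option word :=
  match x, y with
  | Some u, Some v => Some (word_cat u v)
  | _, _ => None
  end.

Definition Sc_mul (x y : option word) : option word :=
  match x, y with
  | Some u, Some v =>
      if [disjoint val u & val v]%fset then Some (word_cat u v) else None
  | _, _ => None
  end.

Fact Sc_nonempty : inhabited (option word).
Proof. exact: (inhabits None). Qed.

Fact Sc_addA : associative Sc_add.
Proof.
by move=> [u|] [v|] [w|] //=; congr Some; apply: val_inj; rewrite /= fsetUA.
Qed.

Fact Sc_addC : commutative Sc_add.
Proof. by move=> [u|] [v|] //=; congr Some; apply: val_inj; rewrite /= fsetUC. Qed.

Fact Sc_addxx : idempotent_op Sc_add.
Proof. by move=> [u|] //=; congr Some; apply: val_inj; rewrite /= fsetUid. Qed.

Fact Sc_mulC : commutative Sc_mul.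
Proof.
move=> [u|] [v|] //=; rewrite fdisjoint_sym; case: ifP => // _.
by congr Some; apply: val_inj; rewrite /= fsetUC.
Qed.

Fact Sc_mulA : associative Sc_mul.
Proof.
move=> [u|] [v|] [w|] //=; last by case: ifP.
case: (boolP [disjoint val v & val w]%fset) => vw;
  case: (boolP [disjoint val u & val v]%fset) => uv //=;
  rewrite ?fdisjointXU ?fdisjointUX ?vw ?uv ?(negPf vw) ?(negPf uv) ?andbF ?andbT //=.
by case: ifP => // _; congr Some; apply: val_inj; rewrite /= fsetUA.
Qed.

Fact Sc_mulDr : right_distributive Sc_mul Sc_add.
Proof.
move=> [u|] [v|] [w|] //=; last by case: ifP.
rewrite fdisjointXU; case: [disjoint val u & val v]%fset => //=.
case: [disjoint val u & val w]%fset => //=.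
by congr Some; apply: val_inj; rewrite /= fsetUUr.
Qed.

Fact Sc_mulDl : left_distributive Sc_mul Sc_add.
Proof. by move=> x y z; rewrite Sc_mulC Sc_mulDr !(Sc_mulC z). Qed.

Definition Sc : aiSemiring :=
  AiSemiring Sc_nonempty Sc_addA Sc_addC Sc_addxx Sc_mulA Sc_mulDl Sc_mulDr.

End SquareFreeWords.

(* S_c^*(a_1 ... a_k): the letter a_i is encoded by the ordinal i - 1. *)
Definition Sc_word (k : nat) : aiSemiring := Sc 'I_k.

(* S_c^*({a_1 ... a_m : m >= 1}): the letter a_i is encoded by i - 1. *)
Definition Sc_infinite : aiSemiring := Sc nat.

(* Main.v *)
From mathcomp Require Import all_boot.
From mathcomp Require Import finmap.
From mathcomp Require Import boolp classical_sets functions cardinality.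
Require Import Defs.

Set Implicit Arguments.
Unset Strict Implicit.
Unset Printing Implicit Defensive.

(**
  Discarding the words that use a letter [>= k] is a homomorphism from the
  infinite semiring to the one on [k] letters, and these homomorphisms jointly
  separate points; this gives the equality of the two varieties.

  In a semiring of square-free words, the value of a term depends only on the
  set of its variables and on the set of pairs of variables that meet in some
  product: the value is 0 iff some variable is 0 or two conflicting variables
  share a letter, and is otherwise the union of the values of the variables.
  So there are finitely many terms in n variables up to equivalence, whence
  local finiteness.

  Finally, the variety satisfies xy = yx, xx = yy and (xx)y = xx, so a member
  with fewer than m elements satisfies x_1 ... x_m = yy by the pigeonhole
  principle, whereas the infinite semiring does not.
*)

(** * Terms and identities *)

Section Terms.
Variable X : Type.

Inductive term := Var of X | Add of term & term | Mul of term & term.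

Fixpoint eval (A : aiSemiring) (e : X -> A) (t : term) : A :=
  match t with
  | Var x => e x
  | Add s t => add (eval e s) (eval e t)
  | Mul s t => mul (eval e s) (eval e t)
  end.

Definition satisfies (s t : term) : algebra_class :=
  fun A => forall e : X -> A, eval e s = eval e t.

Lemma eval_hom (A B : aiSemiring) (f : A -> B) (e : X -> A) (t : term) :
  is_hom f -> f (eval e t) = eval (f \o e) t.
Proof. by case=> fD fM; elim: t => //= s <- t <-; rewrite ?fD ?fM. Qed.

Lemma eval_prod (I : Type) (A : I -> aiSemiring)
    (e : X -> prod_aiSemiring A) (t : term) (i : I) :
  eval e t i = eval (fun x => e x i) t.
Proof. by elim: t => //= s <- t <-. Qed.

(** This is the easy half of Birkhoff's theorem. For a homomorphic image, a valuation is first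
    lifted along the surjection by choice. *)
Lemma variety_satisfies (s t : term) : variety (satisfies s t).
Proof.
split.
- move=> A B f fhom fsurj st e.
  have [g fg] := choice (fun x => fsurj (e x)).
  have -> : e = f \o g by apply: funext => x /=; rewrite fg.
  by rewrite -!eval_hom // st.
- by move=> A B f fhom finj st e; apply: finj; rewrite !eval_hom.
- move=> I A st e; apply: functional_extensionality_dep => i.
  by rewrite !eval_prod; apply: st.
Qed.

Lemma variety_gen_satisfies (F : algebra_class) (s t : term) (A : aiSemiring) :
  (forall B, F B -> satisfies s t B) -> variety_gen F A -> satisfies s t A.
Proof. by move=> FB /(_ _ (variety_satisfies s t)); apply. Qed.

Lemma V_satisfies (S : aiSemiring) (s t : term) (A : aiSemiring) :
  satisfies s t S -> V S A -> satisfies s t A.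
Proof. by move=> st; apply: variety_gen_satisfies => B ->. Qed.

End Terms.

Arguments Var {X} x.

Lemma variety_gen_incl (F : algebra_class) (A : aiSemiring) :
  F A -> variety_gen F A.
Proof. by move=> FA K _; apply. Qed.

(** * Restriction to fewer letters, and the equality of the two varieties *)

Section LetterMaps.
Local Open Scope fset_scope.

Section Restriction.
Variables (T U : choiceType) (f : U -> option T) (g : T -> U).
Hypotheses (gK : pcancel g f) (fK : ocancel f g).

(** Here [g] embeds the alphabet [T] into [U] and [f] is its partial inverse; using [f] makes the
    preimage under [g] visibly finite. *)
Definition pullback (u : {fset U}) : {fset T} := [fset t in pmap f u].

Lemma in_pullback (u : {fset U}) (t : T) : (t \in pullback u) = (g t \in u).
Proof.
rewrite !inE /= mem_pmap; apply/mapP/idP => [[y yu fy]|gu].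
  by have := fK y; rewrite -fy /= => ->.
by exists (g t) => //; rewrite gK.
Qed.

Definition covered (u : word U) : bool := all (fun y => isSome (f y)) (val u).

Lemma coveredP (u : word U) :
  reflect (forall y, y \in val u -> exists t, y = g t) (covered u).
Proof.
apply: (iffP allP) => uf y /uf.
  by have := fK y; case: (f y) => //= t <- _; exists t.
by case=> t ->; rewrite gK.
Qed.

(** The failure case of [insub] never occurs: a covered word is nonempty with all letters in the
    image of [g], so its preimage is nonempty. *)
Definition restrict (x : Sc U) : Sc T :=
  if x is Some u then
    if covered u then insub (pullback (val u)) : option (word T) else None
  else None.

Lemma restrictE (u : word U) : covered u ->
  exists2 v : word T, restrict (Some u) = Some v &
    forall t, (t \in val v) = (g t \in val u).
Proof.
move=> cu; rewrite /= cu.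
have pu : pullback (val u) != fset0.
  have /fset0Pn[y yu] := valP u; have /coveredP/(_ y yu)[t yt] := cu.
  by apply/fset0Pn; exists t; rewrite in_pullback -yt.
pose v : word T := exist (fun X : {fset T} => X != fset0) _ pu.
by rewrite insubT; exists v => // t; rewrite /= in_pullback.
Qed.

Lemma covered_cat (u v : word U) :
  covered (word_cat u v) = covered u && covered v.
Proof.
apply/coveredP/andP => /= [uv|[/coveredP cu /coveredP cv] y].
  by split; apply/coveredP => y yu; apply: uv; rewrite inE yu ?orbT.
by rewrite inE => /orP[/cu|/cv].
Qed.

Lemma restrict_cat (u v : word U) :
  restrict (Some (word_cat u v)) =
  add (restrict (Some u)) (restrict (Some v)).
Proof.
case: (boolP (covered u)) => cu; last first.
  by rewrite /= covered_cat (negPf cu).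
case: (boolP (covered v)) => cv; last first.
  by rewrite /= covered_cat (negPf cv) andbF; case: ifP => //; case: insub.
have cuv : covered (word_cat u v) by rewrite covered_cat cu.
have [u' -> uu'] := restrictE cu; have [v' -> vv'] := restrictE cv.
have [w' -> ww'] := restrictE cuv.
congr Some; apply: val_inj; apply/fsetP => t.
by rewrite ww' !inE uu' vv'.
Qed.

(** The words that are not covered form, with 0, a set absorbing for both operations, so they may be
    collapsed to 0. On covered words every letter comes from [T], so disjointness is preserved and
    reflected. *)
Lemma restrict_is_hom : is_hom restrict.
Proof.
have addN (x : Sc T) : add x None = None by case: x.
have mulN (x : Sc T) : mul x None = None by case: x.
split=> [[u|] [v|]|[u|] [v|]] //; rewrite ?addN ?mulN //.
  exact: restrict_cat.
have -> : mul (Some u : Sc U) (Some v) =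
          if [disjoint val u & val v]%fset then Some (word_cat u v) else None by [].
case: (boolP (covered u)) => cu; last first.
  rewrite [restrict (Some u)]/= (negPf cu).
  by case: ifP => // _; rewrite /= covered_cat (negPf cu).
case: (boolP (covered v)) => cv; last first.
  rewrite [restrict (Some v)]/= (negPf cv) mulN.
  by case: ifP => // _; rewrite /= covered_cat (negPf cv) andbF.
have := restrict_cat u v.
have [u' -> uu'] := restrictE cu; have [v' -> vv'] := restrictE cv.
rewrite [add _ _]/= [mul _ _]/= => ruv.
have -> : [disjoint val u' & val v']%fset = [disjoint val u & val v]%fset.
  apply/fdisjointP/fdisjointP => [uv y yu|uv t].
    move/coveredP/(_ y yu): cu => [t yt]; subst y.
    by rewrite -vv'; apply: uv; rewrite uu'.
  by rewrite uu' vv'; apply: uv.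
by case: ifP.
Qed.

Lemma restrict_surj (y : Sc T) : exists x, restrict x = y.
Proof.
case: y => [v|]; last by exists None.
have gv : g @` val v != fset0.
  have /fset0Pn[t tv] := valP v.
  by apply/fset0Pn; exists (g t); apply/imfsetP; exists t.
have g_inj : injective g := pcan_inj gK.
pose gw : word U := exist (fun X : {fset U} => X != fset0) _ gv.
have cv : covered gw.
  by apply/coveredP => y /imfsetP[t _ ->]; exists t.
exists (Some gw); have [w -> ww] := restrictE cv.
by congr Some; apply: val_inj; apply/fsetP => t; rewrite ww /= mem_imfset.
Qed.

End Restriction.

Lemma insub_ord_ocancel (k : nat) :
  ocancel (insub : nat -> option 'I_k) (@nat_of_ord k).
Proof. by move=> i; case: insubP => //= j _ ->. Qed.

Definition truncate (k : nat) : Sc_infinite -> Sc_word k :=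
  restrict (insub : nat -> option 'I_k).

Lemma truncate_is_hom (k : nat) : is_hom (@truncate k).
Proof. exact: restrict_is_hom (@valK _ _ _) (@insub_ord_ocancel k). Qed.

Lemma truncate_some (u : word nat) (k : nat) :
  (forall i, i \in val u -> i < k) ->
  exists2 v : word 'I_k, truncate k (Some u) = Some v &
    forall j : 'I_k, (j \in val v) = (nat_of_ord j \in val u).
Proof.
move=> uk; apply: restrictE (@valK _ _ _) (@insub_ord_ocancel k) _ _.
by apply/allP => i /uk ik; rewrite insubT.
Qed.

Lemma letters_bounded (u : {fset nat}) : exists k, forall i, i \in u -> i < k.
Proof.
exists (\max_(i <- u) i).+1 => i iu.
by rewrite ltnS; apply: leq_bigmax_seq.
Qed.

(** Two words use finitely many letters, so some truncation keeps all letters of both. The index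
    [k.+1] avoids the empty alphabet, which the join excludes. *)
Lemma truncate_separates (x y : Sc_infinite) :
  (forall k, truncate k.+1 x = truncate k.+1 y) -> x = y.
Proof.
move=> xy.
have some_neq_none (u : word nat) : exists k, truncate k.+1 (Some u) <> None.
  have [k uk] := letters_bounded (val u); exists k.
  by have [|v -> _] := @truncate_some u k.+1 => // i /uk /ltnW.
case: x y xy => [u|] [v|] // xy; last 2 first.
- by have [k] := some_neq_none u; rewrite xy.
- by have [k] := some_neq_none v; rewrite -xy.
have [k uvk] := letters_bounded (val u `|` val v).
have uk i : i \in val u -> i < k.+1.
  by move=> iu; apply/ltnW/uvk; rewrite inE iu.
have vk i : i \in val v -> i < k.+1.
  by move=> iv; apply/ltnW/uvk; rewrite inE iv orbT.
have [u' eu uu'] := truncate_some uk; have [v' ev vv'] := truncate_some vk.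
move: (xy k); rewrite eu ev => -[uv']; subst v'.
congr Some; apply: val_inj; apply/fsetP => i.
have [ik|ki] := ltnP i k.+1.
  by rewrite -(uu' (Ordinal ik)) -(vv' (Ordinal ik)).
by apply/idP/idP => [/uk|/vk]; rewrite ltnNge ki.
Qed.

End LetterMaps.

Lemma truncate_surj (k : nat) (y : Sc_word k) : exists x, truncate k x = y.
Proof. exact: restrict_surj (@valK _ _ _) (@insub_ord_ocancel k) y. Qed.

Lemma V_Sc_infinite_join :
  same_class (V Sc_infinite)
    (variety_join (fun k : nat => 1 <= k) (fun k : nat => V (Sc_word k))).
Proof.
move=> A; split=> [VA K Kvar KS|JA K Kvar KS].
  apply: VA => // _ ->; case: (Kvar) => _ Ksub Kprod.
  (* The truncations together embed the infinite semiring into the product of the finite ones. *)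
  pose f (x : Sc_infinite) : prod_aiSemiring (fun k => Sc_word k.+1) :=
    fun k => truncate k.+1 x.
  apply: (Ksub _ _ f).
  - split=> x y; apply: functional_extensionality_dep => k;
      have [fD fM] := truncate_is_hom k.+1; [exact: fD|exact: fM].
  - by move=> x y /(congr1 (@^~ _)) xy; apply: truncate_separates => k; apply: xy.
  - apply: Kprod => k; apply: KS; exists k.+1 => //.
    exact: variety_gen_incl.
apply: JA => // B [k _]; apply=> // _ ->.
case: Kvar => Kimg _ _; apply: (Kimg _ _ (truncate k)).
- exact: truncate_is_hom.
- exact: truncate_surj.
- exact: KS.
Qed.

(** * Variables and conflicts determine the value of a term *)

Section Signature.
Variable X : finType.

Fixpoint vars (t : term X) : {set X} :=
  match t with
  | Var x => [set x]
  | Add s t | Mul s t => vars s :|: vars t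
  end.

(** Diagonal pairs may occur: a variable present in both factors of a product conflicts with itself,
    which forces the value 0 because words are nonempty. *)
Fixpoint conflicts (t : term X) : {set X * X} :=
  match t with
  | Var x => finset.set0
  | Add s t => conflicts s :|: conflicts t
  | Mul s t => conflicts s :|: conflicts t :|: finset.setX (vars s) (vars t)
  end.

Variables (T : choiceType) (e : X -> Sc T).

(** The value 0 gets no letters, so it never violates a disjointness condition; the first clause of
    [nonzero_signature] excludes it separately. *)
Definition letters (x : X) : {fset T} :=
  if e x is Some u then val u else fset0.

Definition nonzero_signature (V : {set X}) (C : {set X * X}) : Prop :=
  (forall x, x \in V -> e x <> None) /\
  (forall p, p \in C -> [disjoint letters p.1 & letters p.2]%fset).

Definition has_letters (V : {set X}) (u : word T) : Prop :=
  forall a, (a \in val u) = [exists x in V, a \in letters x].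

Lemma has_letters_cat (V W : {set X}) (u v : word T) :
  has_letters V u -> has_letters W v -> has_letters (V :|: W) (word_cat u v).
Proof.
move=> uV vW a; rewrite inE uV vW; apply/orP/exists_inP.
  by case=> /exists_inP[x xV ax]; exists x; rewrite // inE xV ?orbT.
by case=> x /setUP[] xV ax; [left|right]; apply/exists_inP; exists x.
Qed.

Lemma nonzero_signatureU (V W : {set X}) (C D : {set X * X}) :
  nonzero_signature (V :|: W) (C :|: D) <->
  nonzero_signature V C /\ nonzero_signature W D.
Proof.
split=> [[nz dj]|[[nzV djC] [nzW djD]]].
  by split; split=> [x xV|p pC]; [apply: nz|apply: dj|apply: nz|apply: dj];
    rewrite inE ?xV ?pC ?orbT.
by split=> [x /setUP[/nzV|/nzW]|p /setUP[/djC|/djD]].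
Qed.

Lemma disjoint_letters (V W : {set X}) (u v : word T) :
  has_letters V u -> has_letters W v ->
  reflect (forall p, p \in finset.setX V W ->
             [disjoint letters p.1 & letters p.2]%fset)
          [disjoint val u & val v]%fset.
Proof.
move=> uV vW.
apply: (iffP (@fdisjointP _ (val u) (val v))) =>
    [uv [x y] /finset.setXP[/= xV yW]|uv a].
  apply/fdisjointP => a ax; have : a \notin val v.
    by apply: uv; rewrite uV; apply/exists_inP; exists x.
  by apply: contra => ay; rewrite vW; apply/exists_inP; exists y.
rewrite uV vW => /exists_inP[x xV ax]; apply/exists_inP => -[y yW].
have /fdisjointP/(_ a ax)/negP := uv (x, y) (introT finset.setXP (conj xV yW)).
exact.
Qed.

(** By induction on the term. A product of nonzero values vanishes exactly when some variable of the
    left factor shares a letter with some variable of the right one, and these are the pairs that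
    [Mul] adds to the conflicts. *)
Lemma eval_signature (t : term X) :
  if eval e t is Some u
  then nonzero_signature (vars t) (conflicts t) /\ has_letters (vars t) u
  else ~ nonzero_signature (vars t) (conflicts t).
Proof.
elim: t => [x|s IHs t IHt|s IHs t IHt] /=.
- case ex: (e x) => [u|]; last by case=> /(_ x); rewrite inE eqxx ex => /(_ erefl).
  split.
    by split=> [y /set1P->|p]; rewrite ?ex ?inE.
  move=> a; apply/idP/exists_inP => [au|[y /set1P->]].
    by exists x; rewrite ?inE // /letters ex.
  by rewrite /letters ex.
- case: (eval e s) IHs => [u [nu uV]|ns]; last by move=> /nonzero_signatureU[].
  case: (eval e t) IHt => [v [nv vV]|nt]; last by move=> /nonzero_signatureU[].
  by split; [apply/nonzero_signatureU|apply: has_letters_cat].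
- have split_conflicts :
      nonzero_signature (vars s :|: vars t)
        (conflicts s :|: conflicts t :|: finset.setX (vars s) (vars t)) ->
      nonzero_signature (vars s) (conflicts s) /\
      nonzero_signature (vars t) (conflicts t).
    case=> nz dj; apply/nonzero_signatureU; split=> // p pC; apply: dj.
    by rewrite inE pC.
  case: (eval e s) IHs => [u [nu uV]|ns]; last by move=> /split_conflicts[].
  case: (eval e t) IHt => [v [nv vV]|nt]; last by move=> /split_conflicts[].
  rewrite /=; case: (disjoint_letters uV vV) => uv.
    split; last exact: has_letters_cat.
    have [nz dj] := (nonzero_signatureU _ _ _ _).2 (conj nu nv).
    by split=> // p /setUP[/dj|/uv].
  by case=> _ dj; apply: uv => p pC; apply: dj; rewrite inE pC orbT.
Qed.

End Signature.

Lemma satisfies_signature (X : finType) (T : choiceType) (s t : term X) :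
  vars s = vars t -> conflicts s = conflicts t -> satisfies s t (Sc T).
Proof.
move=> vst cst e; have := eval_signature e s; have := eval_signature e t.
rewrite vst cst.
case: (eval e s) => [u|]; case: (eval e t) => [v|] //.
- move=> [_ lv] [_ lu]; congr Some; apply: val_inj; apply/fsetP => a.
  by rewrite lu lv.
- by move=> + [].
- by case.
Qed.

(** * Local finiteness *)

Lemma finite_generators (A : aiSemiring) (G : set A) :
  finite_set G ->
  exists (n : nat) (g : 'I_n -> A), forall x, G x -> exists i, g i = x.
Proof.
case=> n /card_set_bijP[f [fn finj fsurj]]; exists n.
have /choice[g gP] (i : 'I_n) : exists x, G x /\ f x = i.
  by have [x Gx fx] := fsurj i (ltn_ord i); exists x.
exists g => x Gx; exists (Ordinal (fn x Gx)).
have [Gg fg] := gP (Ordinal (fn x Gx)).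
by apply: finj; rewrite ?inE.
Qed.

Lemma locally_finite_V_Sc (T : choiceType) : locally_finite (V (Sc T)).
Proof.
move=> A VA [G Gfin Ggen].
have [n [g gG]] := finite_generators Gfin.
(* The values of terms form a subalgebra that contains the generators. *)
have value x : exists t, eval g t = x.
  have : [set: A]%classic x by [].
  rewrite -Ggen; apply: (@smallest_sub _ _ _ [set x | exists t, eval g t = x]).
    by move=> _ _ [s <-] [t <-]; split; [exists (Add s t)|exists (Mul s t)].
  by move=> y /gG[i gi]; exists (Var i).
pose value_of (sg : {set 'I_n} * {set 'I_n * 'I_n}) (x : A) :=
  exists t, sg = (vars t, conflicts t) /\ eval g t = x.
have value_of_inj sg x y : value_of sg x -> value_of sg y -> x = y.
  move=> [s [-> <-]] [t [[vst cst] <-]].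
  exact: (V_satisfies (satisfies_signature vst cst) VA).
have [a0] := carrier_nonempty A.
(* Turn the functional relation into a map from the finite set of signatures onto [A]; [a0] is the
   default for pairs that no term realizes. *)
have /choice[h hP] sg : exists y, forall x, value_of sg x -> y = x.
  have [[x vx]|nov] := pselect (exists x, value_of sg x).
    by exists x => y; apply: value_of_inj.
  by exists a0 => x vx; case: nov; exists x.
have hfin : finite_set (h @` [set: _])%classic by exact/finite_image/finite_finset.
apply: sub_finite_set hfin => x _; have [t tx] := value x.
by exists (vars t, conflicts t) => //; apply: hP; exists t.
Qed.

(** * Long products vanish in finite members but not in the infinite semiring *)

Fixpoint monomial (m : nat) : term nat :=
  if m is k.+1 then Mul (monomial k) (Var m) else Var 0.

Section NilpotentMembers.
Variables (T : choiceType) (A : aiSemiring).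
Hypothesis VA : V (Sc T) A.

Lemma V_Sc_mulC : commutative (@mul A).
Proof.
move=> x y.
have st : satisfies (Mul (Var true) (Var false)) (Mul (Var false) (Var true)) (Sc T).
  by move=> e /=; apply: Sc_mulC.
exact: (V_satisfies st VA (fun b => if b then x else y)).
Qed.

Lemma Sc_sqr (x : Sc T) : mul x x = None.
Proof.
case: x => [u|] //=; case: ifP => // /fdisjointP uu.
have /fset0Pn[a au] := valP u.
by have := uu a au; rewrite au.
Qed.

Lemma V_Sc_sqr_eq (x y : A) : mul x x = mul y y.
Proof.
have st : satisfies (Mul (Var true) (Var true)) (Mul (Var false) (Var false)) (Sc T).
  by move=> e; rewrite /eval !Sc_sqr.
exact: (V_satisfies st VA (fun b => if b then x else y)).
Qed.

(** With no constant in the signature, the common value of all squares plays the role of the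
    multiplicative zero. *)
Lemma V_Sc_sqr_mul (x y : A) : mul (mul x x) y = mul x x.
Proof.
have st : satisfies (Mul (Mul (Var true) (Var true)) (Var false))
                    (Mul (Var true) (Var true)) (Sc T).
  by move=> e; rewrite /eval !Sc_sqr.
exact: (V_satisfies st VA (fun b => if b then x else y)).
Qed.

(** Commutativity brings the two copies of [e j] together; their square then absorbs the remaining
    factors. *)
Lemma monomial_mul_factor (e : nat -> A) (m j : nat) (y : A) : j <= m ->
  mul (eval e (monomial m)) (e j) = mul y y.
Proof.
elim: m => [|m IHm]; first by rewrite leqn0 => /eqP->; apply: V_Sc_sqr_eq.
rewrite leq_eqVlt => /predU1P[->|/IHm jm] /=; rewrite -mulA.
  by rewrite V_Sc_mulC (V_Sc_sqr_eq _ y) V_Sc_sqr_mul.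
by rewrite (V_Sc_mulC (e m.+1)) mulA jm V_Sc_sqr_mul.
Qed.

Lemma monomial_repeated_factor (e : nat -> A) (m i j : nat) (y : A) :
  i < j -> j <= m -> e i = e j -> eval e (monomial m) = mul y y.
Proof.
move=> ij + eij; elim: m => [|m IHm]; first by rewrite leqn0; case: j ij eij.
rewrite leq_eqVlt => /predU1P[jm|/IHm /= ->]; last exact: V_Sc_sqr_mul.
by rewrite /= -jm -eij; apply: monomial_mul_factor; rewrite -ltnS -jm.
Qed.

(** Take for [N] the number of elements of [A]. For [N <= m] the monomial has [m.+1] factors, so two
    of the first [N.+1] coincide. *)
Lemma finite_monomial_zero : finite_algebra A ->
  exists N, forall m, N <= m ->
    satisfies (monomial m) (Mul (Var 0) (Var 0)) A.
Proof.
case=> N /card_set_bijP[f [fN finj _]]; exists N => m Nm e.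
pose F (i : 'I_N.+1) : 'I_N := Ordinal (fN (e i) I).
have /injectivePn[i [j ij Fij]] : ~~ injectiveb F.
  by apply/injectiveP => /leq_card; rewrite !card_ord ltnn.
have eij : e i = e j.
  by apply: finj; rewrite ?in_setT //; move/(congr1 val): Fij.
have im (k : 'I_N.+1) : k <= m by apply: leq_trans Nm; rewrite -ltnS.
have [lt_ij|lt_ji|/val_inj eq_ij] := ltngtP i j.
- exact: monomial_repeated_factor lt_ij (im j) eij.
- exact: monomial_repeated_factor lt_ji (im i) (esym eij).
- by rewrite eq_ij eqxx in ij.
Qed.

End NilpotentMembers.

Fact letter_subproof (i : nat) : [fset i]%fset != fset0.
Proof. by apply/fset0Pn; exists i; rewrite inE. Qed.

Definition letter (i : nat) : word nat :=
  exist _ [fset i]%fset (letter_subproof i).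

(** The bound on the letters ensures that the next factor is a new letter, so the product never
    becomes 0. *)
Lemma monomial_letters (m : nat) :
  exists2 u : word nat,
    eval (Some \o letter : nat -> Sc_infinite) (monomial m) = Some u &
    forall i, i \in val u -> i <= m.
Proof.
elim: m => [|m [u /= -> um]].
  by exists (letter 0) => // i; rewrite inE => /eqP->.
rewrite /= ifT; last first.
  by apply/fdisjointP => i /um im; rewrite inE neq_ltn ltnS im.
eexists; first by [].
by move=> i /=; rewrite !inE => /orP[/um/leqW|/eqP->].
Qed.

Lemma V_Sc_infinite_not_finite :
  ~ generated_by_finitely_many_finite (V Sc_infinite).
Proof.
case=> n [A [Afin AV]].
have /choice[N NP] (i : 'I_n) : exists N, forall m, N <= m ->
    satisfies (monomial m) (Mul (Var 0) (Var 0)) (A i).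
  apply: (@finite_monomial_zero nat) => //.
  by apply/AV; apply: variety_gen_incl; exists i.
(* One length that works for all the generating algebras at once. *)
pose m := \max_(i < n) N i.
have : satisfies (monomial m) (Mul (Var 0) (Var 0)) Sc_infinite.
  apply: (@variety_gen_satisfies _ (fun B => exists i, B = A i)).
    by move=> _ [i ->]; apply: NP; apply: leq_bigmax.
  by apply/AV; apply: variety_gen_incl.
(* Under distinct single letters the monomial is a word, while the square is 0. *)
move=> /(_ (Some \o letter)); have [u -> _] := monomial_letters m.
by rewrite [RHS]Sc_sqr.
Qed.

Theorem corollary5p3 :
  [/\ same_class (V Sc_infinite)
                 (variety_join (fun k : nat => 1 <= k)
                               (fun k : nat => V (Sc_word k))),
      locally_finite (V Sc_infinite)
    & ~ generated_by_finitely_many_finite (V Sc_infinite)].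
Proof.
split.
- exact: V_Sc_infinite_join.
- exact: locally_finite_V_Sc.
- exact: V_Sc_infinite_not_finite.
Qed.
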